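(* For every prime $m>3$, the Cartesian product graph $\Gamma(\mathbb{Z}_9)\times\Gamma(\mathbb{Z}_{m^2})$ admits a distance antimagic labeling.
   Context: For an integer $n \geq 2$, the zero-divisor graph $\Gamma(\mathbb{Z}_n)$ is the simple graph whose vertex set is the set of nonzero zero-divisors of the ring $\mathbb{Z}_n$, two distinct vertices $u,v$ being adjacent iff $uv \equiv 0 \pmod n$. The Cartesian product $G\times H$ has vertex set $V(G)\times V(H)$, with $(u,v)$ adjacent to $(u',v')$ iff either $u=u'$ and $vv'\in E(H)$, or $v=v'$ and $uu'\in E(G)$. A distance antimagic labeling (DAML) of a graph $G$ with $N$ vertices is a bijection $f:V(G)\to\{1,\dots,N\}$ such that the weights $w(v)=\sum_{u\in N(v)} f(u)$, where $N(v)$ is the open neighbourhood of $v$, are pairwise distinct over all vertices $v$. A graph admits DAML if such a labeling exists. *)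

(* Defs.v *)
From mathcomp Require Import all_boot all_algebra.

Set Implicit Arguments.
Unset Strict Implicit.
Unset Printing Implicit Defensive.

Import GRing.Theory.

Record sgraph := SGraph {
  vertex :> finType;
  adj : rel vertex;
  adj_sym : symmetric adj;
  adj_irrefl : irreflexive adj }.

Section CartesianProduct.
Variables G H : sgraph.

Definition cart_adj : rel (G * H) := fun p q =>
  ((p.1 == q.1) && adj p.2 q.2) || ((p.2 == q.2) && adj p.1 q.1).

Lemma cart_adj_sym : symmetric cart_adj.
Proof.
by move=> p q; rewrite /cart_adj !(eq_sym (p.1)) !(eq_sym (p.2)) !(adj_sym _ p.2) !(adj_sym _ p.1).
Qed.

Lemma cart_adj_irrefl : irreflexive cart_adj.
Proof. by move=> p; rewrite /cart_adj !adj_irrefl !andbF. Qed.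

Definition cart_prod : sgraph := SGraph cart_adj_sym cart_adj_irrefl.

End CartesianProduct.

(* 'Z_n is the ring of integers mod n only for n >= 2; for n < 2 it is Z/2. *)
Section ZeroDivisorGraph.
Variable n : nat.
Local Open Scope ring_scope.

Definition zero_divisor (x : 'Z_n) : bool :=
  [exists y : 'Z_n, (y != 0) && (x * y == 0)].

Definition zd_vertex : finType := {x : 'Z_n | (x != 0) && zero_divisor x}.

Definition zd_adj : rel zd_vertex := fun u v =>
  (u != v) && (val u * val v == 0).

Lemma zd_adj_sym : symmetric zd_adj.
Proof. by move=> u v; rewrite /zd_adj eq_sym mulrC. Qed.

Lemma zd_adj_irrefl : irreflexive zd_adj.
Proof. by move=> u; rewrite /zd_adj eqxx. Qed.

Definition zd_graph : sgraph := SGraph zd_adj_sym zd_adj_irrefl.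

End ZeroDivisorGraph.

Section DistanceAntimagic.
Variable G : sgraph.

Definition weight (f : G -> nat) (v : G) : nat := \sum_(u : G | adj v u) f u.

(* The first three clauses say that f is a bijection onto {1, ..., #|G|}. *)
Definition DAML (f : G -> nat) : Prop :=
  [/\ injective f,
      forall v, 1 <= f v <= #|G|,
      forall k, 1 <= k <= #|G| -> exists v, f v = k
    & injective (weight f)].

Definition admits_DAML : Prop := exists f : G -> nat, DAML f.

End DistanceAntimagic.

(* Main.v *)
(** For a prime [p], the nonzero zero divisors of [Z/p^2] are the [p - 1]
    multiples of [p], and any two of them multiply to [0].  Hence the graph is
    the product of the complete graphs on [2] and [k = m - 1 >= 4] vertices.
    Label column [i] of this 2 x k grid by [2k - i] (top) and [i + 1] (bottom).
    The column differences [d i = 2k - 2i - 1] are distinct and sum to [k ^ 2].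
    If [A] and [B] are the row sums, the weights are [A - d i] and [B + d i],
    and they can only collide if [d i + d j = A - B = k ^ 2], which is
    impossible because [d i + d j <= 4k - 2 < k ^ 2]. *)

Require Import Defs.
From mathcomp Require Import all_boot all_algebra.
From mathcomp Require Import zify.

Definition complete (G : sgraph) : Prop := forall x y : G, adj x y = (x != y).

(** These are the first [n] odd numbers in decreasing order, so peeling off the largest one leaves
    the sum for [n - 1]. *)
Lemma sum_odd_rev n : \sum_(i < n) (n.*2 - i.*2.+1) = n ^ 2.
Proof.
elim: n => [|n IHn]; first by rewrite big_ord0.
rewrite big_ord_recl -[in RHS]addn1 sqrnD -IHn /=.
under eq_bigr => i _ do rewrite [bump _ _]add1n doubleS !subSS.
by lia.
Qed.

Section CompleteProduct.
Variables G H : sgraph.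
Hypotheses (cG : complete G) (cH : complete H).

Lemma weight_cart_complete (f : cart_prod G H -> nat) (u : G) (v : H) :
  weight f (u, v) = \sum_(y | y != v) f (u, y) + \sum_(x | x != u) f (x, v).
Proof.
transitivity (\sum_(x : G) \sum_(y : H | @adj (cart_prod G H) (u, v) (x, y))
                f (x, y)).
  by rewrite pair_big_dep; apply: eq_big => [[x y]|[x y] _].
(* Row [u] contributes all its vertices but [(u, v)]; every other row meets the neighbourhood only
   in column [v]. *)
rewrite (bigD1 u) //=; congr (_ + _).
  by apply: eq_bigl => y; rewrite /cart_adj /= eqxx cH cG eqxx andbF orbF eq_sym.
apply: eq_bigr => x xu; apply: big_pred1 => y.
by rewrite /cart_adj /= cG (eq_sym u) (negPf xu) andbT /= eq_sym.
Qed.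

(** Adding the vertex's own label completes the row sum, which no longer depends on [v], and avoids
    truncated subtraction. *)
Lemma weight_cart_completeD (f : cart_prod G H -> nat) (u : G) (v : H) :
  weight f (u, v) + f (u, v) = \sum_y f (u, y) + \sum_(x | x != u) f (x, v).
Proof. by rewrite weight_cart_complete [in RHS](bigD1 v) //= addnAC (addnC (f _)). Qed.

Lemma DAML_cart_complete :
  #|G| = 2 -> 4 <= #|H| -> admits_DAML (cart_prod G H).
Proof.
move=> card_G; set k := #|H| => k_ge4.
have [u0 [u1 [u01 Gu]]] : exists u0 u1 : G, u0 != u1 /\
    forall u, u = u0 \/ u = u1.
  have /cards2P[u0 [u1 [u01 GE]]] : #|[set: G]| == 2 by rewrite cardsT card_G.
  exists u0, u1; split=> // u; move: (in_setT u); rewrite GE !inE.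
  by case/orP=> /eqP; [left | right].
have u10 : (u1 == u0) = false by rewrite eq_sym (negPf u01).
pose r (v : H) : nat := enum_rank v.
have r_lt v : r v < k by exact: ltn_ord.
have r_inj : injective r by move=> v w /val_inj /enum_rank_inj.
have r_surj i : i < k -> exists v, r v = i.
  by move=> ik; exists (enum_val (Ordinal ik)); rewrite /r enum_valK.
(* As [r v < k], nothing is truncated: row [u0] takes the values k+1, ..., 2k and row [u1] the
   values 1, ..., k. *)
pose f (p : cart_prod G H) := if p.1 == u0 then k.*2 - r p.2 else (r p.2).+1.
have f0 v : f (u0, v) = k.*2 - r v by rewrite /f /= eqxx.
have f1 v : f (u1, v) = (r v).+1 by rewrite /f /= u10.
have cardGH : #|cart_prod G H| = k.*2.
  by rewrite (card_prod G H) card_G mul2n.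
have row_sums : \sum_y f (u0, y) = \sum_y f (u1, y) + k ^ 2.
  have -> : k ^ 2 = \sum_y (k.*2 - (r y).*2.+1).
    by rewrite -sum_odd_rev (reindex (@enum_rank H)) //; apply/onW_bij/enum_rank_bij.
  rewrite -big_split; apply: eq_bigr => y _; rewrite f0 f1 /=.
  by have := r_lt y; lia.
have w0 v : weight f (u0, v) + f (u0, v) = \sum_y f (u0, y) + f (u1, v).
  rewrite weight_cart_completeD (big_pred1 u1) // => x /=.
  by case: (Gu x) => ->; rewrite ?eqxx ?u10 // (negPf u01).
have w1 v : weight f (u1, v) + f (u1, v) = \sum_y f (u1, y) + f (u0, v).
  rewrite weight_cart_completeD (big_pred1 u0) // => x /=.
  by case: (Gu x) => ->; rewrite ?eqxx ?u10 // (negPf u01).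
exists f; split.
- move=> [x v] [y w]; have := r_lt v; have := r_lt w.
  by case: (Gu x) => ->; case: (Gu y) => -> ? ?; rewrite ?f0 ?f1 => fE;
     [congr pair; apply: r_inj | exfalso | exfalso | congr pair; apply: r_inj];
     lia.
- move=> [x v]; rewrite cardGH; have := r_lt v.
  by case: (Gu x) => ->; rewrite ?f0 ?f1; lia.
- move=> j; rewrite cardGH => j_bounds; case: (leqP j k) => jk.
    have [|v rv] := r_surj j.-1; first by lia.
    by exists (u1, v); rewrite f1 rv; lia.
  have [|v rv] := r_surj (k.*2 - j); first by lia.
  by exists (u0, v); rewrite f0 rv; lia.
(* Here [k >= 4] enters: this bound excludes equal weights in different rows. *)
- have k2 : 4 * k <= k ^ 2 by rewrite -mulnn leq_mul2r k_ge4 orbT.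
  move=> [x v] [y w]; have := r_lt v; have := r_lt w.
  case: (Gu x) => ->; case: (Gu y) => -> ? ? wE;
    move: (w0 v) (w0 w) (w1 v) (w1 w); rewrite !f0 !f1 => *;
    [congr pair; apply: r_inj | exfalso | exfalso | congr pair; apply: r_inj];
    lia.
Qed.

End CompleteProduct.

Section PrimeSquare.
Variable p : nat.
Hypothesis p_prime : prime p.

(** This is the side condition of [Zp_cast], under which the modulus of ['Z_(p ^ 2)] really is
    [p ^ 2]. *)
Let sq_gt1 : 1 < p ^ 2.
Proof. by rewrite -(exp1n 2) ltn_exp2r // prime_gt1. Qed.

Lemma Zsq_mul_eq0 (x y : 'Z_(p ^ 2)) : (x * y == 0)%R = (p ^ 2 %| x * y).
Proof. by rewrite -val_eqE /= [X in _ %% X]Zp_cast. Qed.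

Lemma Zsq_ltn (x : 'Z_(p ^ 2)) : x < p ^ 2.
Proof. by rewrite -[X in _ < X]Zp_cast. Qed.

(** If [p] does not divide [x], then [x] is coprime to [p ^ 2], which would have to divide some [y]
    with 0 < y < p^2. Otherwise [p] itself annihilates [x]. *)
Lemma zero_divisor_sq (x : 'Z_(p ^ 2)) : zero_divisor x = (p %| x).
Proof.
apply/existsP/idP => [[y /andP[y0]] | px].
  rewrite Zsq_mul_eq0; apply: contraLR => npx.
  rewrite Gauss_dvdr ?coprimeXl ?prime_coprime //.
  by rewrite gtnNdvd ?lt0n ?Zsq_ltn.
have p_lt : p < (Zp_trunc (p ^ 2)).+2.
  by rewrite Zp_cast // -[X in X < _]expn1 ltn_exp2l ?prime_gt1.
exists (Ordinal p_lt); rewrite Zsq_mul_eq0 -[X in X %| _]mulnn dvdn_mul // andbT.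
by rewrite -val_eqE /= -lt0n prime_gt0.
Qed.

Lemma zd_graph_sq_complete : complete (zd_graph (p ^ 2)).
Proof.
move=> u v; rewrite /= /zd_adj; case: eqP => //= _.
have [/andP[_]] := (valP u, valP v); rewrite zero_divisor_sq => pu.
case/andP=> _; rewrite zero_divisor_sq => pv.
by rewrite Zsq_mul_eq0 -[X in X %| _]mulnn dvdn_mul.
Qed.

Lemma card_zd_graph_sq : #|zd_graph (p ^ 2)| = p.-1.
Proof.
have p_gt0 := prime_gt0 p_prime.
have mul_lt (i : 'I_p.-1) : i.+1 * p < (Zp_trunc (p ^ 2)).+2.
  by rewrite Zp_cast // -mulnn ltn_pmul2r //; have := ltn_ord i; lia.
(* The shift by one skips the multiple 0, so [g] enumerates exactly the vertices. *)
pose g i : 'Z_(p ^ 2) := Ordinal (mul_lt i).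
have g_inj : injective g.
  move=> i j /(congr1 val) /= /eqP; rewrite eqn_pmul2r // eqSS => /eqP.
  exact: val_inj.
rewrite card_sig -[RHS]card_ord -(card_codom g_inj); apply: eq_card => x.
rewrite !inE zero_divisor_sq; apply/andP/codomP => [[x0 /dvdnP[q xE]] | [i ->]].
  have qp : q < p by have := Zsq_ltn x; rewrite xE -mulnn ltn_pmul2r.
  have q_gt0 : 0 < q.
    by rewrite lt0n; apply: contra x0 => /eqP q0; rewrite -val_eqE /= xE q0.
  have q_lt : q.-1 < p.-1 by lia.
  by exists (Ordinal q_lt); apply: val_inj; rewrite /= prednK.
by rewrite -val_eqE /= -lt0n muln_gt0 p_gt0 dvdn_mull.
Qed.

End PrimeSquare.

Theorem theorem2p11 (m : nat) (m_prime : prime m) (m_gt3 : 3 < m) :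
  admits_DAML (cart_prod (zd_graph 9) (zd_graph (m ^ 2))).
Proof.
(* Excluding 4 improves [3 < m] to m >= 5, hence m - 1 >= 4. *)
have m_neq4 : m != 4 by apply: contraTneq m_prime => ->.
apply: DAML_cart_complete.
(* [9] and [3 ^ 2] are convertible. *)
- exact: (@zd_graph_sq_complete 3).
- exact: zd_graph_sq_complete.
- exact: (@card_zd_graph_sq 3).
- by rewrite card_zd_graph_sq //; lia.
Qed.
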